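(* Let $r\ge 3$ and $l$ be positive integers. Let $G$ be a left-compressed $r$-uniform graph on the vertex set $[l]$ with edge set $E$ such that there is a one-to-one function $f$ from $E_{(l-1)l}$ to $[l-2]^{(r-1)}\setminus E_l$ satisfying: for each $i_1i_2\cdots i_{r-2}\in E_{(l-1)l}$ with $i_1< i_2<\cdots< i_{r-2}$, the set $f(i_1i_2\cdots i_{r-2})=j_1j_2\cdots j_{r-1}$ with $j_1<j_2<\cdots<j_{r-1}$ satisfies $j_k\le i_{k+1}$ for all $1\le k\le r-3$. (a) If $G$ contains $[l-1]^{(r)}$, then $\lambda(G)=\lambda([l-1]^{(r)})$. (b) If $G$ does not contain $[l-1]^{(r)}$, then $\lambda(G)<\lambda([l-1]^{(r)})$.
   Context: An $r$-uniform graph ($r$-graph) $G$ on $[l]=\{1,\dots,l\}$ has edge set $E\subseteq[l]^{(r)}$, where $V^{(k)}$ denotes the family of $k$-element subsets of $V$ and $[n]^{(r)}$ also denotes the complete $r$-graph on $[n]$. For a vertex $i$, $E_i=\{A\in[l]^{(r-1)}: A\cup\{i\}\in E\}$; for vertices $i,j$, $E_{ij}=\{B\in[l]^{(r-2)}: B\cup\{i,j\}\in E\}$. For $\vec x\in S=\{\vec x\in\mathbb{R}^l:\sum_i x_i=1,\ x_i\ge0\}$, $\lambda(G,\vec x)=\sum_{i_1\cdots i_r\in E}x_{i_1}\cdots x_{i_r}$ and the Lagrangian is $\lambda(G)=\max_{\vec x\in S}\lambda(G,\vec x)$. $G$ is left-compressed if whenever $j_1\cdots j_r\in E$ and $i_k\le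 j_k$ for all $k$ (with $i_1,\dots,i_r$ distinct), then $i_1\cdots i_r\in E$. *)

(* Defs.v *)
From mathcomp Require Import all_boot all_order all_algebra.
From mathcomp Require Import all_classical all_reals all_analysis.
Import Order.TTheory GRing.Theory Num.Theory.
Import numFieldNormedType.Exports.

Set Implicit Arguments.
Unset Strict Implicit.
Unset Printing Implicit Defensive.

Local Open Scope ring_scope.

(* The vertex set [l] = {1, ..., l} is represented by 'I_l; the vertex with
   label i is the ordinal u such that u.+1 = i. *)

(* The subset [m] = {1, ..., m} of [l] (for m <= l). *)
Definition seg (l m : nat) : {set 'I_l} := [set u : 'I_l | (u < m)%N].

(* V^(k) *)
Definition ksubsets (l : nat) (V : {set 'I_l}) (k : nat) : {set {set 'I_l}} :=
  [set A : {set 'I_l} | (A \subset V) && (#|A| == k)].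

Definition uniform (l r : nat) (E : {set {set 'I_l}}) : bool :=
  E \subset ksubsets [set: 'I_l] r.

Definition complete (n r : nat) : {set {set 'I_n}} := ksubsets [set: 'I_n] r.

(* E_i and E_ij, indexed by vertex labels; they are empty when i or j is not
   the label of a vertex. *)
Definition link1 (l r : nat) (E : {set {set 'I_l}}) (i : nat) :
    {set {set 'I_l}} :=
  [set A in ksubsets [set: 'I_l] r.-1 |
    [exists u : 'I_l, (u.+1 == i) && (u |: A \in E)]].

Definition link2 (l r : nat) (E : {set {set 'I_l}}) (i j : nat) :
    {set {set 'I_l}} :=
  [set B in ksubsets [set: 'I_l] r.-2 |
    [exists u : 'I_l, exists v : 'I_l,
      [&& u.+1 == i, v.+1 == j & u |: (v |: B) \in E]]].

Definition left_compressed (l r : nat) (E : {set {set 'I_l}}) : Prop :=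
  forall i j : 'I_r -> 'I_l,
    injective i ->
    (forall k, (i k <= j k)%N) ->
    [set j k | k : 'I_r] \in E -> [set i k | k : 'I_r] \in E.

Definition labels (l : nat) (A : {set 'I_l}) : seq nat :=
  [seq (u : 'I_l).+1 | u <- enum A].

Lemma labels_sorted (l : nat) (A : {set 'I_l}) : sorted ltn (labels A).
Proof.
rewrite /labels (map_comp succn val) sorted_map.
rewrite (@eq_sorted _ _ ltn) //.
apply: (subseq_sorted ltn_trans _ (iota_ltn_sorted 0 l)).
rewrite -val_enum_ord; apply: map_subseq.
by rewrite enumT; exact: filter_subseq.
Qed.

(* i_k for A = {i_1 < i_2 < ...}, with k counted from 1. *)
Definition kth (l : nat) (A : {set 'I_l}) (k : nat) : nat :=
  nth 0%N (labels A) k.-1.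

Definition simplex (R : realType) (l : nat) : set 'rV[R]_l :=
  [set x : 'rV[R]_l | (forall i, 0 <= x 0 i) /\ \sum_(i < l) x 0 i = 1]%classic.
Arguments simplex : clear implicits.

Definition lagrange_poly (R : realType) (l : nat) (E : {set {set 'I_l}})
    (x : 'rV[R]_l) : R :=
  \sum_(A in E) \prod_(i in A) x 0 i.

(* The supremum is a maximum for l > 0 (lagrangian_max below); for l = 0 the
   simplex is empty and the value is 0. *)
Definition lagrangian (R : realType) (l : nat) (E : {set {set 'I_l}}) : R :=
  sup [set lagrange_poly E x | x in simplex R l]%classic.

Lemma lagrange_poly_continuous (R : realType) (l : nat)
    (E : {set {set 'I_l}}) :
  continuous (@lagrange_poly R l E).
Proof.
apply: (continuous_big (@add_continuous R^o)) => A _.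
apply: (continuous_big (@mul_continuous R)) => i _.
exact: coord_continuous.
Qed.

Lemma simplex_compact (R : realType) (l : nat) : compact (simplex R l).
Proof.
apply: bounded_closed_compact.
  exists 1; split; first exact: num_real.
  move=> M M1 x [x0 x1]; rewrite /Num.norm /= mx_normrE.
  apply/bigmax_leP; split=> [|[i j] _] /=; first by apply: ltW; apply: lt_trans M1.
  rewrite (ord1 i) ger0_norm //; apply: le_trans (ltW M1).
  by rewrite -x1 (bigD1 j) //= lerDl sumr_ge0.
rewrite (_ : simplex R l =
  ((\bigcap_(i in [set: 'I_l]) [set x : 'rV[R]_l | 0 <= x 0 i]) `&`
   [set x : 'rV[R]_l | \sum_(i < l) x 0 i = 1])%classic); last first.
  apply/seteqP; split => x [x0 x1]; split => //.
    by move=> i _; exact: x0.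
  by move=> i; exact: x0.
apply: closedI.
  apply: closed_bigI => i _.
  apply: (@preimage_closed _ _ (fun x : 'rV[R]_l => x 0 i) [set y | 0 <= y]%classic).
    by move=> x _; exact: coord_continuous.
  exact: closed_ge.
apply: (@preimage_closed _ _ (fun x : 'rV[R]_l => \sum_(i < l) x 0 i)
  [set y | y = 1]%classic).
  move=> x _; move: x; apply: (continuous_big (@add_continuous R^o)) => i _.
  exact: coord_continuous.
exact: closed_eq.
Qed.

Lemma lagrangian_max (R : realType) (l : nat) (E : {set {set 'I_l}}) :
  (0 < l)%N ->
  exists x : 'rV[R]_l,
    [/\ simplex R l x, lagrange_poly E x = lagrangian R E
      & forall y, simplex R l y -> lagrange_poly E y <= lagrangian R E].
Proof.
case: l E => // l E _.
have S0 : (simplex R l.+1 !=set0)%classic.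
  exists (delta_mx 0 0); split => [i|]; first by rewrite mxE ler0n.
  rewrite (bigD1 0) //= mxE !eqxx big1 ?addr0 // => i i0.
  by rewrite mxE (negPf i0) andbF.
have cf : {within simplex R l.+1, continuous (@lagrange_poly R l.+1 E)}%classic.
  exact/continuous_subspaceT/lagrange_poly_continuous.
have [c cS cmax] := EVT_max_rV S0 (@simplex_compact R l.+1) cf.
rewrite inE in cS.
have cmax' y : simplex R l.+1 y -> lagrange_poly E y <= lagrange_poly E c.
  by move=> yS; apply: cmax; rewrite inE.
suff -> : lagrangian R E = lagrange_poly E c by exists c.
apply/le_anti/andP; split.
  by apply: ge_sup => [|_ [y yS <-]]; [exists (lagrange_poly E c); exists c|exact: cmax'].
apply: ub_le_sup; last by exists c.
by exists (lagrange_poly E c) => _ [y yS <-]; exact: cmax'.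
Qed.

(* Main.v *)
Require Import Defs.
From mathcomp Require Import all_boot all_order all_algebra.
From mathcomp Require Import all_classical all_reals all_analysis.
From mathcomp Require Import ring lra zify.
Import Order.TTheory GRing.Theory Num.Theory.
Local Open Scope ring_scope.

Set Implicit Arguments.
Unset Strict Implicit.
Unset Printing Implicit Defensive.

(* Let [x] be a maximizer for [E], where [E] contains all [r]-subsets of
   [l-1]. If some weight vanishes, deleting that vertex bounds the value by
   that of the complete graph on [l-1] vertices. Otherwise moving weight
   between two vertices [i], [j] does not change the value to first order,
   so that the link values satisfy
     [link_out i j - link_out j i = (x_i - x_j) link_both i j].
   If no edge contains both [l-1] and [l], the weight of [l] can be moved to
   [l-1] at no cost and the previous case applies; otherwise the stationarity
   equations and the injection [f] contradict each other ([link_both_eq0]).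
   For (b), adding the missing edges within [l-1] preserves the hypotheses, and
   the strict inequality holds since a proper subgraph loses value at a
   positive weighting while all maximizers of a complete graph are positive. *)

(** * Links of a vertex or a pair, and expansion of the polynomial along them *)

Definition link_at (l : nat) (E : {set {set 'I_l}}) (i : 'I_l) :
    {set {set 'I_l}} :=
  [set B : {set 'I_l} | (i \notin B) && (i |: B \in E)].

Definition del_at (l : nat) (E : {set {set 'I_l}}) (i : 'I_l) :
    {set {set 'I_l}} :=
  [set B : {set 'I_l} | (i \notin B) && (B \in E)].

(** Sets that complete both [i] and [j] to an edge are kept; they cancel in the difference between
    [link_out E i j] and [link_out E j i]. *)
Definition link_out (l : nat) (E : {set {set 'I_l}}) (i j : 'I_l) :
    {set {set 'I_l}} :=
  [set B : {set 'I_l} | [&& i \notin B, j \notin B & i |: B \in E]].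

Definition link_both (l : nat) (E : {set {set 'I_l}}) (i j : 'I_l) :
    {set {set 'I_l}} :=
  [set B : {set 'I_l} | [&& i \notin B, j \notin B & i |: (j |: B) \in E]].

Lemma lagrange_poly_split (R : realType) (l : nat) (E : {set {set 'I_l}})
    (i : 'I_l) (x : 'rV[R]_l) :
  lagrange_poly E x =
  x 0 i * lagrange_poly (link_at E i) x + lagrange_poly (del_at E i) x.
Proof.
rewrite /lagrange_poly (bigID (fun A : {set 'I_l} => i \in A)) /=; congr (_ + _).
  rewrite (reindex_onto (fun B : {set 'I_l} => i |: B) (fun A => A :\ i)) /=.
    rewrite big_distrr /=; apply: eq_big => [B|B].
      rewrite !inE eqxx /= andbT andbC; congr (_ && _).
      apply/eqP/idP => [<-|iB]; first by rewrite !inE eqxx.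
      by rewrite finset.setU1K.
    case/andP => _ /eqP eB; rewrite big_setU1 //.
    by rewrite -eB !inE eqxx.
  by move=> A /andP[_ iA]; rewrite finset.setD1K.
by apply: eq_bigl => A; rewrite !inE andbC.
Qed.

Lemma lagrange_poly_split2 (R : realType) (l : nat) (E : {set {set 'I_l}})
    (i j : 'I_l) (x : 'rV[R]_l) : i != j ->
  lagrange_poly E x =
  x 0 i * x 0 j * lagrange_poly (link_both E i j) x
  + x 0 i * lagrange_poly (link_out E i j) x
  + x 0 j * lagrange_poly (link_out E j i) x
  + lagrange_poly (del_at (del_at E i) j) x.
Proof.
move=> ij; rewrite (lagrange_poly_split E i) (lagrange_poly_split (link_at E i) j).
rewrite (lagrange_poly_split (del_at E i) j) mulrDr !mulrA !addrA.
have -> : link_at (link_at E i) j = link_both E i j.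
  by apply/finset.setP => B; rewrite !inE (negPf ij) /= andbCA.
have -> : del_at (link_at E i) j = link_out E i j.
  by apply/finset.setP => B; rewrite !inE /= andbCA.
have -> // : link_at (del_at E i) j = link_out E j i.
by apply/finset.setP => B; rewrite !inE (negPf ij).
Qed.

Lemma lagrange_poly_ge0 (R : realType) (l : nat) (E : {set {set 'I_l}})
    (x : 'rV[R]_l) : (forall k, 0 <= x 0 k) -> 0 <= lagrange_poly E x.
Proof. by move=> x0; apply: sumr_ge0 => A _; apply: prodr_ge0. Qed.

Lemma lagrange_poly_gt0 (R : realType) (l : nat) (E : {set {set 'I_l}})
    (x : 'rV[R]_l) (B : {set 'I_l}) : (forall k, 0 <= x 0 k) ->
  B \in E -> (forall k, k \in B -> 0 < x 0 k) -> 0 < lagrange_poly E x.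
Proof.
move=> x0 BE xB; rewrite /lagrange_poly (bigD1 B) //= ltr_wpDr ?prodr_gt0 //.
by apply: sumr_ge0 => A _; apply: prodr_ge0.
Qed.

Lemma lagrange_poly_sub (R : realType) (l : nat) (E E' : {set {set 'I_l}})
    (x : 'rV[R]_l) : (forall k, 0 <= x 0 k) -> E \subset E' ->
  lagrange_poly E' x = lagrange_poly E x + lagrange_poly (E' :\: E) x.
Proof.
move=> x0 sE; rewrite /lagrange_poly (big_setID E) /=.
by rewrite (finset.setIidPr sE).
Qed.

Lemma lagrange_poly_le (R : realType) (l : nat) (E E' : {set {set 'I_l}})
    (x : 'rV[R]_l) : (forall k, 0 <= x 0 k) -> E \subset E' ->
  lagrange_poly E x <= lagrange_poly E' x.
Proof.
by move=> x0 sE; rewrite (lagrange_poly_sub x0 sE) lerDl lagrange_poly_ge0.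
Qed.

Lemma lagrange_poly_eq (R : realType) (l : nat) (E : {set {set 'I_l}})
    (x y : 'rV[R]_l) :
  (forall A, A \in E -> forall k, k \in A -> x 0 k = y 0 k) ->
  lagrange_poly E x = lagrange_poly E y.
Proof. by move=> xy; apply: eq_bigr => A AE; apply: eq_bigr => k; exact: xy. Qed.

(** * Moving weight between two vertices; stationarity at a maximizer *)

Definition transfer (R : realType) (l : nat) (x : 'rV[R]_l) (i j : 'I_l)
    (t : R) : 'rV[R]_l :=
  \row_k (if k == i then x 0 i + t else if k == j then x 0 j - t else x 0 k).

Lemma transfer_simplex (R : realType) (l : nat) (x : 'rV[R]_l) (i j : 'I_l)
    (t : R) : i != j -> simplex R l x -> - x 0 i <= t <= x 0 j ->
  simplex R l (transfer x i j t).
Proof.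
move=> ij [x0 x1] /andP[t1 t2]; split=> [k|].
  rewrite mxE; case: ifP => _; first lra.
  by case: ifP => _ //; lra.
rewrite -x1 (bigD1 i) //= (bigD1 j) 1?eq_sym //= [RHS](bigD1 i) //=.
rewrite [X in _ = _ + X](bigD1 j) 1?eq_sym //= !mxE eqxx eq_sym (negPf ij) eqxx.
rewrite (eq_bigr (fun k => x 0 k)) => [|k /andP[ki kj]]; first by ring.
by rewrite mxE (negPf ki) (negPf kj).
Qed.

(** The polynomial is affine in each coordinate separately, so along a transfer it is exactly
    quadratic in [t]. *)
Lemma lagrange_poly_transfer (R : realType) (l : nat) (E : {set {set 'I_l}})
    (x : 'rV[R]_l) (i j : 'I_l) (t : R) : i != j ->
  lagrange_poly E (transfer x i j t) = lagrange_poly E x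
  + t * ((x 0 j - x 0 i) * lagrange_poly (link_both E i j) x
         + lagrange_poly (link_out E i j) x - lagrange_poly (link_out E j i) x)
  - t ^+ 2 * lagrange_poly (link_both E i j) x.
Proof.
move=> ij.
have same (E' : {set {set 'I_l}}) : (forall A : {set 'I_l}, A \in E' -> (i \notin A) && (j \notin A)) ->
    lagrange_poly E' (transfer x i j t) = lagrange_poly E' x.
  move=> h; apply: lagrange_poly_eq => A /h/andP[iA jA] k kA; rewrite mxE.
  by rewrite !ifN //; apply: contraTneq kA => ->.
rewrite !(lagrange_poly_split2 E _ ij) !same;
  try by move=> A; rewrite !inE => /and3P[-> ->].
rewrite !mxE eqxx [j == i]eq_sym (negPf ij) eqxx; ring.
Qed.

(** A nonzero slope [d] would beat the quadratic term for small [t] of the same sign; reversing [t]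
    and swapping [p] with [q] reduces to [0 <= d]. *)
Lemma slope_eq0 (R : realType) (a d p q : R) : 0 <= a -> 0 < p -> 0 < q ->
  (forall t, - p <= t <= q -> t * d - t ^+ 2 * a <= 0) -> d = 0.
Proof.
move=> a0; wlog d0 : d p q / 0 <= d => [hw|] p0 q0 h.
  have [d0|d0] := leP 0 d; first exact: (hw d p q).
  apply/eqP; rewrite -oppr_eq0; apply/eqP; apply: (hw (- d) q p) => //; first lra.
  move=> t /andP[t1 t2]; have := h (- t); rewrite sqrrN mulNr mulrN; apply.
  by apply/andP; split; lra.
apply/eqP; rewrite eq_le d0 andbT leNgt; apply/negP => dp.
(* The bound [d / (a + 1)] forces [t * a < d] and also covers [a = 0]. *)
pose t := Num.min q (d / (a + 1)).
have t0 : 0 < t by rewrite lt_min q0 divr_gt0 //; lra.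
have /h : - p <= t <= q by rewrite ge_min lexx andbT; lra.
apply/negP; rewrite -ltNge expr2 -mulrA -mulrBr mulr_gt0 // subr_gt0.
have : t <= d / (a + 1) by rewrite ge_min lexx orbT.
rewrite ler_pdivlMr ?mulrDr; lra.
Qed.

(** Both weights being positive, small transfers are possible in both directions, so the linear
    coefficient of [lagrange_poly_transfer] vanishes. *)
Lemma stationary (R : realType) (l : nat) (E : {set {set 'I_l}})
    (x : 'rV[R]_l) (i j : 'I_l) : i != j -> simplex R l x ->
  (forall y, simplex R l y -> lagrange_poly E y <= lagrange_poly E x) ->
  0 < x 0 i -> 0 < x 0 j ->
  lagrange_poly (link_out E i j) x - lagrange_poly (link_out E j i) x =
  (x 0 i - x 0 j) * lagrange_poly (link_both E i j) x.
Proof.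
move=> ij xS opt xi xj.
suff : (x 0 j - x 0 i) * lagrange_poly (link_both E i j) x
    + lagrange_poly (link_out E i j) x - lagrange_poly (link_out E j i) x = 0.
  lra.
have a0 := lagrange_poly_ge0 (link_both E i j) xS.1.
apply: (slope_eq0 a0 xi xj) => t ht.
have := opt _ (transfer_simplex ij xS ht).
rewrite lagrange_poly_transfer //; lra.
Qed.

(** * Deleting a vertex of weight zero *)

Definition delete_vertex (n : nat) (E : {set {set 'I_n.+1}}) (v : 'I_n.+1) :
    {set {set 'I_n}} :=
  [set A : {set 'I_n} | [set lift v k | k in A] \in E].

Definition restrict (R : realType) (n : nat) (v : 'I_n.+1) (x : 'rV[R]_n.+1) :
    'rV[R]_n := \row_k x 0 (lift v k).

Definition extend (R : realType) (n : nat) (v : 'I_n.+1) (y : 'rV[R]_n) :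
    'rV[R]_n.+1 := \row_i (if unlift v i is Some k then y 0 k else 0).

Lemma lift_preimset (n : nat) (v : 'I_n.+1) (B : {set 'I_n.+1}) :
  v \notin B -> [set lift v k | k in lift v @^-1: B] = B.
Proof.
move=> vB; apply/finset.setP => i.
case: (unliftP v i) => [k|] ->; first by rewrite mem_imset ?inE //; exact: lift_inj.
rewrite (negPf vB); apply/imsetP => -[k _ /eqP].
by rewrite (negPf (neq_lift _ _)).
Qed.

Lemma lagrange_poly_delete (R : realType) (n : nat) (E : {set {set 'I_n.+1}})
    (v : 'I_n.+1) (x : 'rV[R]_n.+1) : x 0 v = 0 ->
  lagrange_poly E x = lagrange_poly (delete_vertex E v) (restrict v x).
Proof.
move=> xv; rewrite (lagrange_poly_split E v) xv mul0r add0r /lagrange_poly.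
rewrite (reindex_onto (fun A : {set 'I_n} => [set lift v k | k in A])
  (fun B : {set 'I_n.+1} => lift v @^-1: B)) /=.
  apply: eq_big => [A|A _].
    rewrite !inE.
    have -> : v \notin [set lift v k | k in A].
      by apply/imsetP => -[k _ /eqP]; rewrite (negPf (neq_lift _ _)).
    rewrite (_ : lift v @^-1: _ == A) ?andbT //; apply/eqP/finset.setP => k.
    by rewrite inE mem_imset //; exact: lift_inj.
  rewrite big_imset /=; last by move=> ? ? _ _; exact: lift_inj.
  by apply: eq_bigr => k _; rewrite mxE.
by move=> B; rewrite inE => /andP[vB _]; exact: lift_preimset.
Qed.

Lemma restrict_simplex (R : realType) (n : nat) (v : 'I_n.+1) (x : 'rV[R]_n.+1) :
  x 0 v = 0 -> simplex R n.+1 x -> simplex R n (restrict v x).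
Proof.
move=> xv [x0 x1]; split=> [k|]; first by rewrite mxE.
rewrite -x1 (bigD1_ord v) //= xv add0r.
by apply: eq_bigr => k _; rewrite mxE.
Qed.

Lemma extend_at (R : realType) (n : nat) (v : 'I_n.+1) (y : 'rV[R]_n) :
  extend v y 0 v = 0.
Proof. by rewrite mxE unlift_none. Qed.

Lemma extendK (R : realType) (n : nat) (v : 'I_n.+1) (y : 'rV[R]_n) :
  restrict v (extend v y) = y.
Proof. by apply/rowP => k; rewrite !mxE liftK. Qed.

Lemma extend_simplex (R : realType) (n : nat) (v : 'I_n.+1) (y : 'rV[R]_n) :
  simplex R n y -> simplex R n.+1 (extend v y).
Proof.
move=> [y0 y1]; split=> [i|]; first by rewrite mxE; case: unlift.
rewrite -y1 (bigD1_ord v) //= extend_at add0r.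
by apply: eq_bigr => k _; rewrite mxE liftK.
Qed.

Lemma uniform_delete (r n : nat) (E : {set {set 'I_n.+1}}) (v : 'I_n.+1) :
  uniform r E -> delete_vertex E v \subset complete n r.
Proof.
move=> /fintype.subsetP uE; apply/fintype.subsetP => A; rewrite !inE => /uE.
rewrite !inE !finset.subsetT /= card_imset //; exact: lift_inj.
Qed.

Lemma lagrange_poly_le_lagrangian (R : realType) (l : nat)
    (E : {set {set 'I_l}}) (x : 'rV[R]_l) :
  (0 < l)%N -> simplex R l x -> lagrange_poly E x <= lagrangian R E.
Proof. by move=> l0; have [_ [_ _ h]] := lagrangian_max R E l0; exact: h. Qed.

(** * Complete graphs, their maximizers, and comparison with them *)

Lemma card_seg (l m : nat) : (m <= l)%N -> #|seg l m| = m.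
Proof.
move=> ml; have inj : injective (widen_ord ml).
  by move=> a b /(congr1 val) /= /val_inj.
rewrite -[RHS]card_ord -(card_imset _ inj).
apply: eq_card => u; rewrite inE; apply/idP/imsetP => [um|[k _ ->]] /=.
  by exists (Ordinal um) => //; exact: val_inj.
exact: ltn_ord.
Qed.

Lemma lagrangian_complete_gt0 (R : realType) (n r : nat) :
  (0 < n)%N -> (r <= n)%N -> 0 < lagrangian R (complete n r).
Proof.
move=> n0 rn; pose y : 'rV[R]_n := const_mx n%:R^-1.
have y0 k : 0 < y 0 k by rewrite mxE invr_gt0 ltr0n.
have yS : simplex R n y.
  split=> [k|]; first exact: ltW.
  under eq_bigr do rewrite mxE.
  by rewrite sumr_const card_ord -[_ *+ n]mulr_natr mulVf // pnatr_eq0 -lt0n.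
apply: lt_le_trans (lagrange_poly_le_lagrangian (complete n r) n0 yS).
apply: (@lagrange_poly_gt0 _ _ _ _ (seg n r)) => //; first by move=> k; exact: ltW.
by rewrite !inE finset.subsetT card_seg /=.
Qed.

(** A vertex [w] of weight zero could take half the weight of a vertex [u] on an edge of positive
    weights. The complete graph is symmetric, so the outer links of [w] and [u] agree and the value
    would grow by [(y_u / 2) ^ 2] times that of [link_both]. *)
Lemma complete_maximizer_gt0 (R : realType) (n r : nat) (y : 'rV[R]_n) :
  (2 <= r)%N -> (r <= n)%N -> simplex R n y ->
  lagrange_poly (complete n r) y = lagrangian R (complete n r) ->
  forall w, 0 < y 0 w.
Proof.
move=> r2 rn yS yopt w; have y0 := yS.1.
have n0 : (0 < n)%N by lia.
rewrite lt_neqAle y0 andbT eq_sym; apply/eqP => yw.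
have [A AK yA] : exists2 A : {set 'I_n}, A \in complete n r &
    (forall k, k \in A -> 0 < y 0 k).
  have : lagrange_poly (complete n r) y != 0.
    by rewrite yopt gt_eqF // lagrangian_complete_gt0.
  apply: contra_neqP => h; apply: big1 => A AK; apply/eqP.
  apply: contra_notT h => /prodf_neq0 h; exists A => // k kA.
  by rewrite lt_neqAle y0 eq_sym h.
have /andP[_ /eqP cA] : (A \subset [set: 'I_n]) && (#|A| == r) by move: AK; rewrite inE.
have wA : w \notin A by apply/negP => /yA; rewrite yw ltxx.
have [u uA] : exists u, u \in A by apply/card_gt0P; rewrite cA; lia.
have cAu : (#|A| = 1 + #|A :\ u|)%N by rewrite (cardsD1 u) uA.
(* A second vertex [u'] of [A], available as [2 <= r], makes room for [w]: the set [A] without [u]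
   and [u'] lies in [link_both]. *)
have [u' uA'] : exists u', u' \in A :\ u by apply/card_gt0P; lia.
have cAu' : (#|A :\ u| = 1 + #|A :\ u :\ u'|)%N by rewrite (cardsD1 u') uA'.
have wu : w != u by apply: contraNneq wA => ->.
have BF : A :\ u :\ u' \in link_both (complete n r) w u.
  rewrite !inE eqxx (negPf wA) !andbF /= finset.subsetT cardsU1 cardsU1 !inE.
  by rewrite eqxx (negPf wA) (negPf wu) !andbF /=; rewrite -cAu' -cAu cA.
have a0 : 0 < lagrange_poly (link_both (complete n r) w u) y.
  by apply: (lagrange_poly_gt0 y0 BF) => k; rewrite !inE => /and3P[_ _ /yA].
have sym : link_out (complete n r) w u = link_out (complete n r) u w.
  apply/finset.setP => B; rewrite !inE !finset.subsetT /=.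
  case: (boolP (w \in B)) => wB; rewrite ?andbF //=.
  by case: (boolP (u \in B)) => uB; rewrite ?andbF //= !cardsU1 wB uB.
have yu := yA _ uA.
have tS : - y 0 w <= y 0 u / 2 <= y 0 u by rewrite yw; lra.
have := lagrange_poly_le_lagrangian (complete n r) n0 (transfer_simplex wu yS tS).
rewrite lagrange_poly_transfer // sym yw yopt subr0 addrK.
have := mulr_gt0 (mulr_gt0 yu yu) a0; lra.
Qed.

(** If [y] is not a maximizer of the complete graph, strictness is immediate; if it is, all weights
    are positive and the missing edge [e] costs a positive amount. *)
Lemma proper_subgraph_lt (R : realType) (n r : nat) (E : {set {set 'I_n}})
    (y : 'rV[R]_n) : (2 <= r)%N -> (r <= n)%N -> E \proper complete n r ->
  simplex R n y -> lagrange_poly E y < lagrangian R (complete n r).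
Proof.
move=> r2 rn /properP[EK [e eK eE]] yS; have y0 := yS.1.
have n0 : (0 < n)%N by lia.
have leK := lagrange_poly_le_lagrangian (complete n r) n0 yS.
have := lagrange_poly_sub y0 EK.
have := lagrange_poly_ge0 (complete n r :\: E) y0.
have [yopt|] := eqVneq (lagrange_poly (complete n r) y) (lagrangian R (complete n r)).
  have yp := complete_maximizer_gt0 r2 rn yS yopt.
  have : 0 < lagrange_poly (complete n r :\: E) y.
    by apply: (lagrange_poly_gt0 y0 (B := e)) => //; rewrite inE eE eK.
  lra.
move=> neK; have : lagrange_poly (complete n r) y < lagrangian R (complete n r).
  by rewrite lt_neqAle neK leK.
lra.
Qed.

Lemma zero_weight_le (R : realType) (r n : nat) (E : {set {set 'I_n.+1}})
    (v : 'I_n.+1) (x : 'rV[R]_n.+1) : (0 < n)%N -> uniform r E ->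
  simplex R n.+1 x -> x 0 v = 0 ->
  lagrange_poly E x <= lagrangian R (complete n r).
Proof.
move=> n0 uE xS xv; have yS := restrict_simplex xv xS.
rewrite (lagrange_poly_delete E xv).
apply: le_trans (lagrange_poly_le_lagrangian _ n0 yS).
by apply: lagrange_poly_le yS.1 _; exact: uniform_delete.
Qed.

Lemma lagrangian_complete_le (R : realType) (r n : nat) (E : {set {set 'I_n.+1}}) :
  (0 < n)%N -> ksubsets (seg n.+1 n) r \subset E ->
  lagrangian R (complete n r) <= lagrangian R E.
Proof.
move=> n0 /fintype.subsetP KE.
have [y [yS <- _]] := lagrangian_max R (complete n r) n0.
have xS := extend_simplex ord_max yS.
apply: le_trans (lagrange_poly_le_lagrangian E isT xS).
rewrite (lagrange_poly_delete E (extend_at _ _)) extendK.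
apply: lagrange_poly_le yS.1 _; apply/fintype.subsetP => A.
rewrite !inE finset.subsetT /= => cA; apply: KE.
rewrite inE card_imset ?cA ?andbT; last exact: lift_inj.
by apply/fintype.subsetP => _ /imsetP[k _ ->]; rewrite inE lift_max.
Qed.

(** * Comparing products over sets listed in increasing order *)

Lemma prod_labels (R : realType) (l : nat) (A : {set 'I_l}) (d : 'I_l)
    (z : 'I_l -> R) :
  \prod_(i in A) z i = \prod_(k < #|A|) z (nth d (enum A) k).
Proof. by rewrite -big_enum (big_nth d) big_mkord cardE. Qed.

Lemma kthE (l : nat) (A : {set 'I_l}) (d : 'I_l) (k : nat) :
  (k < #|A|)%N -> kth A k.+1 = (nth d (enum A) k).+1.
Proof. by move=> kA; rewrite /kth /labels (nth_map d) -?cardE. Qed.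

(* All but the two largest elements of [A] are dominated by all but the
   smallest element of [B]; these three leftover elements are only compared
   through the uniform bounds [a] and [c]. *)
Lemma shifted_prod_le (R : realType) (l m : nat) (A B : {set 'I_l})
    (z : 'I_l -> R) (a c : R) :
  #|A| = m.+2 -> #|B| = m.+1 ->
  (forall k, (k < m)%N -> (kth A k.+1 <= kth B k.+2)%N) ->
  {in A & B, forall u v : 'I_l, (u <= v)%N -> z v <= z u} ->
  (forall u, 0 <= z u) -> 0 <= a ->
  {in A, forall u, a <= z u} -> {in B, forall u, z u <= c} ->
  a ^+ 2 * \prod_(i in B) z i <= c * \prod_(i in A) z i.
Proof.
move=> cA cB AB mono z0 a0 aA Bc.
have [d _] : exists d, d \in A by apply/card_gt0P; rewrite cA.
have inA k : (k < m.+2)%N -> nth d (enum A) k \in A.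
  by move=> km; rewrite -mem_enum mem_nth // -cardE cA.
have inB k : (k < m.+1)%N -> nth d (enum B) k \in B.
  by move=> km; rewrite -mem_enum mem_nth // -cardE cB.
rewrite !(prod_labels _ d) cA cB [in leLHS]big_ord_recl.
rewrite [in leRHS]big_ord_recr [in leRHS]big_ord_recr /=.
set P := \prod_(i < m) _; set Q := \prod_(i < m) _.
have PQ : P <= Q.
  apply: ler_prod => k _; rewrite z0 /=; have km := ltn_ord k.
  have k2 : (k < m.+2)%N by lia.
  have k1 : (bump 0 k < m.+1)%N by rewrite /bump; lia.
  apply: (mono _ _ (inA _ k2) (inB _ k1)).
  by have := AB k km; rewrite !(@kthE _ _ d) ?cA ?cB.
have P0 : 0 <= P by apply: prodr_ge0.
have c1 := Bc _ (inB 0%N isT).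
have a1 := aA _ (inA m (leqnSn _)); have a2 := aA _ (inA m.+1 (leqnn _)).
set b := z (nth d (enum B) 0) in c1 *; have b0 : 0 <= b by apply: z0.
rewrite mulrA [X in _ <= X](_ : _ = (z (nth d (enum A) m) * z (nth d (enum A) m.+1))
  * c * Q); last by ring.
apply: ler_pM => //; first by rewrite mulr_ge0 ?sqr_ge0.
by apply: ler_pM => //; rewrite ?sqr_ge0 // expr2; apply: ler_pM.
Qed.

(** * Compression, and the case of a positive maximizer *)

(** Compression as a one-vertex exchange: in an edge, [j] may be replaced by a smaller vertex
    outside it. In this form it compares links directly. *)
Definition shiftable (l : nat) (E : {set {set 'I_l}}) : Prop :=
  forall i j : 'I_l, (i <= j)%N -> link_out E j i \subset link_out E i j.

Lemma left_compressed_shiftable (l r : nat) (E : {set {set 'I_l}}) :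
  uniform r E -> left_compressed r E -> shiftable E.
Proof.
move=> /fintype.subsetP uE cE i j ij; apply/fintype.subsetP => B.
rewrite !inE => /and3P[jB iB jE]; rewrite jB iB /=.
have cj : #|j |: B| = r by have := uE _ jE; rewrite inE => /andP[_ /eqP].
pose J (k : 'I_r) : 'I_l := enum_val (cast_ord (esym cj) k).
have Jinj : injective J by move=> a b /enum_val_inj /cast_ord_inj.
have JE : [set J k | k : 'I_r] = j |: B.
  apply/finset.setP => u; apply/imsetP/idP => [[k _ ->]|uB]; first exact: enum_valP.
  exists (cast_ord cj (enum_rank_in uB u)) => //.
  by rewrite /J cast_ordK enum_rankK_in.
(* Replacing the value [j] by [i] in an enumeration of the edge keeps it injective because [i] is
   not in [B]. *)
pose I (k : 'I_r) := if J k == j then i else J k.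
have JB k : J k != j -> J k \in B.
  move=> kj; have : J k \in j |: B by rewrite -JE imset_f.
  by rewrite !inE (negPf kj).
have <- : [set I k | k : 'I_r] = i |: B.
  apply/finset.setP => u; apply/imsetP/setU1P => [[k _ ->]|].
    by rewrite /I; case: eqP => [_|/eqP /JB]; [left|right].
  case=> [->|uB].
    have : j \in j |: B by rewrite setU11.
    by rewrite -JE => /imsetP[k _ jk]; exists k => //; rewrite /I -jk eqxx.
  have : u \in j |: B by rewrite setU1r.
  rewrite -JE => /imsetP[k _ uk]; exists k => //.
  by rewrite /I -uk ifN //; apply: contraNneq jB => <-.
apply: (cE _ J); last by rewrite JE.
  move=> a b; rewrite /I; case: eqP => [aj|/eqP aj]; case: eqP => [bj|/eqP bj].
  - by move=> _; apply: Jinj; rewrite aj bj.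
  - by move=> ib; move: (JB _ bj); rewrite -ib (negPf iB).
  - by move=> ai; move: (JB _ aj); rewrite ai (negPf iB).
  - exact: Jinj.
by move=> k; rewrite /I; case: eqP => [->|].
Qed.

(** Lowering a vertex stays inside an initial segment. This allows the missing edges to be added in
    (b). *)
Lemma shiftableU_seg (l r m : nat) (E : {set {set 'I_l}}) :
  shiftable E -> shiftable (E :|: ksubsets (seg l m) r).
Proof.
move=> sE i j ij; apply/fintype.subsetP => B.
rewrite !inE => /and3P[jB iB]; rewrite jB iB /= => /orP[jE|].
  have /fintype.subsetP /(_ B) := sE i j ij.
  by rewrite !inE jB iB jE => /(_ isT) /= ->.
rewrite !finset.subUset !finset.sub1set !inE !cardsU1 jB iB => /andP[/andP[jm ->] ->].
by rewrite (leq_ltn_trans ij jm) orbT.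
Qed.

(* With [a = x_p] and [b = x_q], stationarity gives [x_u <= a + b] for every
   [u], hence [a^2 x_B <= (a + b) x_(f B)]; summing over [B] and comparing with
   stationarity for the pair [p], [q] yields [a^2 s <= (a + b) (a - b) s], where
   [s > 0] is the value of [link_both E p q]. *)
Lemma link_both_eq0 (R : realType) (m n : nat) (E : {set {set 'I_n.+2}})
    (p q : 'I_n.+2) (f : {set 'I_n.+2} -> {set 'I_n.+2}) (x : 'rV[R]_n.+2) :
  p = n :> nat -> q = n.+1 :> nat ->
  uniform m.+3 E -> shiftable E -> ksubsets (seg n.+2 n.+1) m.+3 \subset E ->
  {in link_both E p q &, injective f} ->
  {in link_both E p q, forall B,
    [/\ f B \in ksubsets (seg n.+2 n) m.+2, q |: f B \notin E &
      forall k, (k < m)%N -> (kth (f B) k.+1 <= kth B k.+2)%N]} ->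
  simplex R n.+2 x ->
  (forall y, simplex R n.+2 y -> lagrange_poly E y <= lagrange_poly E x) ->
  (forall k, 0 < x 0 k) ->
  link_both E p q = finset.set0.
Proof.
move=> pn qn /fintype.subsetP uE sE /fintype.subsetP KE finj fP xS xopt xp.
have x0 := xS.1.
apply/eqP; apply/set0Pn => -[B0 B0F].
have pq : p != q by rewrite -val_eqE /= pn qn; lia.
have inK (A : {set 'I_n.+2}) : q \notin A -> #|A| = m.+3 -> A \in E.
  move=> qA cA; apply: KE; rewrite inE cA eqxx andbT; apply/fintype.subsetP => u uA.
  rewrite inE; have : u != q by apply: contraNneq qA => <-.
  rewrite -val_eqE /= qn; have := ltn_ord u; lia.
(* The set [f B0] fits into the first [n] vertices; hence any two vertices other than [q] lie in an
   edge avoiding [q]. *)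
have mn : (m.+2 <= n)%N.
  have [] := fP _ B0F; rewrite inE => /andP[/subset_leq_card + /eqP cf] _ _.
  by rewrite cf card_seg //; lia.
have both_gt0 (i j : 'I_n.+2) : i != j -> (i <= n)%N -> (j <= n)%N ->
    0 < lagrange_poly (link_both E i j) x.
  move=> ij iln jln; set S := seg n.+2 n.+1 :\ i :\ j.
  have cS : (n.+1 = #|S| + 2)%N.
    have := @card_seg n.+2 n.+1 (leqnSn _).
    rewrite (cardsD1 i) (cardsD1 j (_ :\ i)) !inE !ltnS iln jln [j == i]eq_sym ij -/S /=; set s := #|S|; lia.
  have : (0 < #|[set A : {set 'I_n.+2} | A \subset S & #|A| == m.+1]|)%N.
    rewrite cards_draws bin_gt0; move: cS; move: #|S| => s; lia.
  case/card_gt0P => A; rewrite inE => /andP[/fintype.subsetP AS /eqP cA].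
  have iA : i \notin A by apply/negP => /AS; rewrite !inE eqxx andbF.
  have jA : j \notin A by apply/negP => /AS; rewrite !inE eqxx.
  apply: (lagrange_poly_gt0 x0 (B := A)) => //; rewrite inE iA jA /=; apply: inK.
    rewrite !inE -!val_eqE /= qn !negb_or; apply/and3P; split; try lia.
    by apply/negP => /AS; rewrite !inE qn ltnn !andbF.
  by rewrite !cardsU1 !inE (negPf ij) iA jA cA.
(* By compression the difference of the outer links is nonnegative, and stationarity makes it
   [x_u - x_v] times a positive value. *)
have mono (u v : 'I_n.+2) : (u <= n)%N -> (v <= n)%N -> (u <= v)%N -> x 0 v <= x 0 u.
  move=> un vn uv; have [->//|uv'] := eqVneq u v.
  have st := stationary uv' xS xopt (xp u) (xp v).
  have := lagrange_poly_le x0 (sE _ _ uv); rewrite -subr_ge0 st.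
  by rewrite pmulr_lge0 ?subr_ge0 // both_gt0.
have bound (u : 'I_n.+2) : (u < n)%N -> x 0 u <= x 0 p + x 0 q.
  move=> un; have up : u != p by rewrite -val_eqE /= pn; lia.
  have leup : (u <= p)%N by rewrite pn; lia.
  have A0 : 0 < lagrange_poly (link_both E u p) x by rewrite both_gt0 ?pn //; lia.
  have st := stationary up xS xopt (xp u) (xp p).
  set D := link_out E u p :\: link_out E p u.
  have eD := lagrange_poly_sub x0 (sE _ _ leup).
  (* Every member of [D] contains [q]: otherwise adding [p] would give a set avoiding [q], which is
     an edge. *)
  have D0 : del_at D q = finset.set0.
    apply/finset.setP => B; rewrite !inE; apply/negP.
    case/and3P => qB /negP + /and3P[uB pB uBE].
    rewrite uB pB /=; apply; apply: inK.
      by rewrite !inE negb_or eq_sym pq.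
    by have := uE _ uBE; rewrite inE !cardsU1 uB pB => /andP[_ /eqP].
  (* Exchanging [q] for [p] in the edge shows that [D] has value at most [x_q] times that of
     [link_both E u p]. *)
  have DA : link_at D q \subset link_both E u p.
    apply/fintype.subsetP => B; rewrite inE => /andP[qB].
    rewrite !inE !negb_or => /andP[_ /and3P[/andP[uq uB] /andP[_ pB] uqBE]].
    rewrite uB pB /=; have lepq : (p <= q)%N by rewrite pn qn.
    have /fintype.subsetP /(_ (u |: B)) := sE _ _ lepq.
    rewrite !inE !negb_or [q == u]eq_sym uq qB [p == u]eq_sym up pB /=.
    by rewrite finset.setUCA => /(_ uqBE); rewrite finset.setUCA.
  have := lagrange_poly_split D q x.
  rewrite D0 [lagrange_poly finset.set0 x]big_set0 addr0 => eq.
  have le := lagrange_poly_le x0 DA.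
  have le2 := ler_wpM2l (x0 q) le.
  rewrite -(ler_pM2r A0) mulrDl; move: eD; rewrite -/D; lra.
have F0 : 0 < lagrange_poly (link_both E p q) x by apply: (lagrange_poly_gt0 x0 B0F).
have lepq : (p <= q)%N by rewrite pn qn.
have st := stationary pq xS xopt (xp p) (xp q).
have eD := lagrange_poly_sub x0 (sE _ _ lepq).
set D := _ :\: _ in eD.
(* Adding [p] to [f B] gives a set avoiding [q], hence an edge, whereas adding [q] does not. *)
have fD : [set f B | B in link_both E p q] \subset D.
  apply/fintype.subsetP => _ /imsetP[B BF ->].
  have [] := fP _ BF; rewrite inE => /andP[/fintype.subsetP fn /eqP cf] qf _.
  have pf : p \notin f B by apply/negP => /fn; rewrite inE pn ltnn.
  have qf' : q \notin f B by apply/negP => /fn; rewrite inE qn; lia.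
  rewrite !inE (negPf qf) pf qf' /=; apply: inK; last by rewrite cardsU1 pf cf.
  by rewrite !inE negb_or qf' andbT eq_sym.
have le1 := lagrange_poly_le x0 fD.
have : x 0 p ^+ 2 * lagrange_poly (link_both E p q) x <=
    (x 0 p + x 0 q) * lagrange_poly [set f B | B in link_both E p q] x.
  rewrite /lagrange_poly big_imset //= !big_distrr /=; apply: ler_sum => B BF.
  have [] := fP _ BF; rewrite inE => /andP[/fintype.subsetP fn /eqP cf] _ fk.
  move: (BF); rewrite inE => /and3P[pB qB /uE].
  rewrite inE !cardsU1 !inE negb_or pq pB qB => /andP[_ /eqP [cB]].
  have Bn (u : 'I_n.+2) : u \in B -> (u < n)%N.
    move=> uB; have : u != p by apply: contraNneq pB => <-.
    have : u != q by apply: contraNneq qB => <-.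
    rewrite -!val_eqE /= pn qn; have := ltn_ord u; lia.
  have fn' (u : 'I_n.+2) : u \in f B -> (u < n)%N by move=> /fn; rewrite inE.
  apply: (shifted_prod_le cf cB fk) => //.
  - by move=> u v /fn' un /Bn vn; apply: mono; exact: ltnW.
  - by move=> u /fn' un; apply: mono; rewrite ?pn // ltnW.
  - by move=> u /Bn; exact: bound.
(* Together these give [a^2 s <= (a^2 - b^2) s], against [b^2 s > 0]. *)
have := ler_wpM2l (addr_ge0 (x0 p) (x0 q)) le1.
have := mulr_gt0 (mulr_gt0 (xp q) (xp q)) F0.
have -> : lagrange_poly D x = (x 0 p - x 0 q) * lagrange_poly (link_both E p q) x.
  lra.
lra.
Qed.

(** * Bounds by the complete graph on one vertex fewer, and the theorem *)

Lemma lagrangian_le_complete (R : realType) (m n : nat) (E : {set {set 'I_n.+2}})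
    (p q : 'I_n.+2) (f : {set 'I_n.+2} -> {set 'I_n.+2}) :
  p = n :> nat -> q = n.+1 :> nat ->
  uniform m.+3 E -> shiftable E -> ksubsets (seg n.+2 n.+1) m.+3 \subset E ->
  {in link_both E p q &, injective f} ->
  {in link_both E p q, forall B,
    [/\ f B \in ksubsets (seg n.+2 n) m.+2, q |: f B \notin E &
      forall k, (k < m)%N -> (kth (f B) k.+1 <= kth B k.+2)%N]} ->
  lagrangian R E <= lagrangian R (complete n.+1 m.+3).
Proof.
move=> pn qn uE sE KE finj fP.
have [x [xS xE xopt]] := lagrangian_max R E isT.
rewrite -xE in xopt *.
have [/existsP[v /eqP xv]|/existsPn xn0] := boolP [exists v, x 0 v == 0].
  exact: zero_weight_le xS xv.
have xp k : 0 < x 0 k by rewrite lt_neqAle xS.1 eq_sym xn0.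
have F0 := link_both_eq0 pn qn uE sE KE finj fP xS xopt xp.
have pq : p != q by rewrite -val_eqE /= pn qn; lia.
have tS : - x 0 p <= x 0 q <= x 0 q.
  by rewrite lexx andbT; apply: le_trans (xS.1 q); rewrite oppr_le0 xS.1.
have := stationary pq xS xopt (xp p) (xp q).
have := lagrange_poly_transfer E x (x 0 q) pq.
(* With [link_both] empty, stationarity kills the remaining linear term, so giving all the weight of
   [q] to [p] leaves the value unchanged. *)
rewrite F0 [lagrange_poly finset.set0 x]big_set0 !mulr0 add0r => + st.
rewrite st mulr0 addr0 subr0 => <-.
apply: (zero_weight_le _ uE (transfer_simplex pq xS tS) (v := q)) => //.
by rewrite mxE eq_sym (negPf pq) eqxx subrr.
Qed.

(** At a positive maximizer, adding the missing edges strictly increases the value. If instead [v]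
    has weight zero, deleting it leaves a proper subgraph of the complete graph, provided some
    non-edge avoids [v]. *)
Lemma lagrangian_lt_complete (R : realType) (r n : nat) (E : {set {set 'I_n.+2}}) :
  (2 <= r)%N -> uniform r E -> shiftable E ->
  ~~ (ksubsets (seg n.+2 n.+1) r \subset E) ->
  lagrangian R (E :|: ksubsets (seg n.+2 n.+1) r) <=
    lagrangian R (complete n.+1 r) ->
  lagrangian R E < lagrangian R (complete n.+1 r).
Proof.
move=> r2 uE sE /subsetPn[e eK eE] leK.
have [x [xS <- _]] := lagrangian_max R E isT.
have [/existsP[v /eqP xv]|/existsPn xn0] := boolP [exists v, x 0 v == 0]; last first.
  have xp k : 0 < x 0 k by rewrite lt_neqAle xS.1 eq_sym xn0.
  apply: lt_le_trans leK; apply: lt_le_trans (lagrange_poly_le_lagrangian _ _ xS) => //.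
  rewrite (lagrange_poly_sub xS.1 (finset.subsetUl E _)) ltrDl.
  by apply: (lagrange_poly_gt0 xS.1 (B := e)) => //; rewrite finset.in_setD finset.in_setU eE eK orbT.
move: (eK); rewrite inE => /andP[esub /eqP ce].
have rn : (r <= n.+1)%N.
  by have := subset_leq_card esub; rewrite ce card_seg.
have me : ord_max \notin e.
  by apply/negP => /(fintype.subsetP esub); rewrite inE ltnn.
(* If [v] lies in the non-edge [e], the last vertex replaces it: were the result an edge, exchanging
   back down to [v] would make [e] an edge. *)
have [e' [ve' ce' eE']] : exists e' : {set 'I_n.+2},
    [/\ v \notin e', #|e'| = r & e' \notin E].
  have [ve|ve] := boolP (v \in e); last by exists e.
  have mB : ord_max \notin e :\ v by rewrite !inE negb_and me orbT.
  have vB : v \notin e :\ v by rewrite !inE eqxx.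
  exists (ord_max |: e :\ v); split.
  - rewrite !inE negb_or eqxx andbT; apply: contraTneq ve => ->.
    exact: me.
  - by rewrite cardsU1 mB -ce (cardsD1 v e) ve.
  apply: contra eE => mE.
  have /fintype.subsetP /(_ (e :\ v)) := sE v ord_max (leq_ord v).
  rewrite [_ \in link_out _ _ _]inE mB vB mE => /(_ isT).
  by rewrite inE finset.setD1K // => /and3P[].
rewrite (lagrange_poly_delete E xv).
apply: proper_subgraph_lt (restrict_simplex xv xS) => //.
apply/properP; split; first exact: uniform_delete.
exists (lift v @^-1: e'); last by rewrite inE lift_preimset.
rewrite inE finset.subsetT -(card_imset _ (@lift_inj _ v)) lift_preimset //.
by rewrite ce' eqxx.
Qed.

Theorem theorem3p6 (R : realType) (r l : nat) (hr : (3 <= r)%N) (hl : (0 < l)%N)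
  (E : {set {set 'I_l}})
  (hE : uniform r E)
  (hcomp : left_compressed r E)
  (hf : exists f : {set 'I_l} -> {set 'I_l},
    [/\ {in link2 r E (l - 1) l &, injective f},
        (forall B, B \in link2 r E (l - 1) l ->
           f B \in ksubsets (seg l (l - 2)) (r - 1) :\: link1 r E l)
      & (forall B, B \in link2 r E (l - 1) l ->
           forall k, (1 <= k <= r - 3)%N -> (kth (f B) k <= kth B k.+1)%N)]) :
  (ksubsets (seg l (l - 1)) r \subset E ->
     lagrangian R E = lagrangian R (complete (l - 1) r)) /\
  (~~ (ksubsets (seg l (l - 1)) r \subset E) ->
     lagrangian R E < lagrangian R (complete (l - 1) r)).
Proof.
have sE := left_compressed_shiftable hE hcomp.
case: l hl E hE hcomp hf sE => [//|[|n]] _ E hE _ [f [finj fK fk]] sE.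
  (* For [l = 1] there are no edges, and the simplex on zero vertices is empty, so both values are
     0, the supremum of the empty set being 0. *)
  have E0 : E = finset.set0.
    apply/finset.setP => A; rewrite inE; apply/negP => /(fintype.subsetP hE).
    rewrite inE => /andP[_ /eqP cA]; have := max_card A; rewrite card_ord cA; lia.
  split=> [_|/subsetPn[A]]; last first.
    rewrite inE => /andP[/subset_leq_card + /eqP cA].
    by rewrite cA card_seg // leqNgt (leq_trans _ hr).
  have [x [_ <- _]] := lagrangian_max R E isT.
  rewrite E0 [LHS]big_set0 /lagrangian (_ : simplex R _ = set0%classic).
    by rewrite image_set0 sup0.
  apply/seteqP; split=> // y [_ /eqP].
  by rewrite big_ord0 eq_sym oner_eq0.
case: r hr hE finj fK fk => [|[|[|m]]] // _ uE finj fK fk.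
rewrite !subn1 subn2 /= in finj fK fk *.
(* With [l = n + 2], the labels [l - 1] and [l] belong to the ordinals [n] and [n + 1]. *)
pose q : 'I_n.+2 := ord_max; pose p : 'I_n.+2 := inord n.
have pn : p = n :> nat by rewrite inordK.
have pq : p != q by rewrite -val_eqE /= pn; lia.
set K := ksubsets (seg n.+2 n.+1) m.+3.
have qK (A : {set 'I_n.+2}) : q \in A -> A \notin K.
  move=> qA; apply/negP; rewrite inE => /andP[/fintype.subsetP /(_ _ qA)].
  by rewrite inE ltnn.
(* No member of [K] contains [q], so adding [K] creates no new edge through [q] and [f] still
   applies. *)
have FE B : B \in link_both (E :|: K) p q -> B \in link2 m.+3 E n.+1 n.+2.
  rewrite inE => /and3P[pB qB]; rewrite inE (negPf (qK _ _)) ?orbF; last first.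
    by rewrite !inE eqxx orbT.
  move=> BE; rewrite !inE finset.subsetT /=; apply/andP; split.
    move: (fintype.subsetP uE _ BE); rewrite inE !cardsU1 !inE negb_or pq pB qB.
    by rewrite finset.subsetT.
  by apply/existsP; exists p; apply/existsP; exists q; rewrite pn !eqxx.
have le : lagrangian R (E :|: K) <= lagrangian R (complete n.+1 m.+3).
  apply: (@lagrangian_le_complete R m n (E :|: K) p q f) => //.
  - rewrite /uniform finset.subUset; apply/andP; split=> //.
    by apply/fintype.subsetP => A; rewrite !inE finset.subsetT => /andP[].
  - exact: shiftableU_seg.
  - exact: finset.subsetUr.
  - by move=> A B /FE AF /FE BF; exact: finj.
  move=> B /FE BF; have := fK _ BF; rewrite inE => /andP[fB1 fB2]; split.
  - exact: fB2.
  - rewrite inE (negPf (qK _ _)) ?orbF; last by rewrite !inE eqxx.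
    apply: contra fB1 => qE; rewrite !inE finset.subsetT /=.
    move: fB2; rewrite inE => /andP[_ ->] /=.
    by apply/existsP; exists q; rewrite eqxx.
  - by move=> k km; apply: fk => //; lia.
split=> [KE|KE]; last exact: lagrangian_lt_complete.
apply/le_anti/andP; split; last exact: lagrangian_complete_le.
by move: le; rewrite (finset.setUidPl KE).
Qed.
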